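(* Let $n$ be a nonnegative integer and let $\Omega$ be the set of perfect matchings of the complete graph $K_{2n}$. Let $t\in\{0,\ldots,n\}$ and let $D\subseteq\Omega$ be a Steiner system of strength $t$, i.e. a $t$-design of index $1$. For each perfect matching $M\in D$, the intersection numbers at $M$ are given by $$\alpha_r(M)=\begin{cases}\displaystyle\binom{n}{r}\sum_{s=0}^{t-1-r}(-1)^s\binom{n-r}{s}\left(\frac{(2(n-r-s)-1)!!}{(2(n-t)-1)!!}-1\right)&\text{if }r\in\{0,\ldots,t-1\},\\ 0&\text{if }r\in\{t,\ldots,n-1\},\\ 1&\text{if }r=n.\end{cases}$$
   Context: $K_{2n}$ is the complete graph on $2n$ vertices. A matching is a set of pairwise disjoint edges; a matching $M$ of $K_{2n}$ is perfect if $\#M=n$. A subset $D\subseteq\Omega$ is a $t$-design of index $\lambda$ if every matching of $K_{2n}$ with exactly $t$ edges is contained in exactly $\lambda$ elements of $D$; it is a Steiner system of strength $t$ if this holds with $\lambda=1$. For $r\in\{0,\ldots,n\}$, $\alpha_r(M)=\#\{M'\in D:\#(M\cap M')=r\}$. For $k\ge 1$, $(2k-1)!!=1\cdot 3\cdot 5\cdots(2k-1)$, and for $k=0$, $(2k-1)!!=1$. *)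

(* Defs.v *)
From mathcomp Require Import all_boot.

Set Implicit Arguments.
Unset Strict Implicit.
Unset Printing Implicit Defensive.

Definition is_edge (V : finType) (e : {set V}) : bool := #|e| == 2.

(* The edges of the complete graph on V are exactly the 2-subsets of V. *)
Definition is_matching (V : finType) (M : {set {set V}}) : bool :=
  [forall e in M, is_edge e] && trivIset M.

Definition perfect_matchings (n : nat) : {set {set {set 'I_(2 * n)}}} :=
  [set M | is_matching M && (#|M| == n)].

Definition is_design (n t lambda : nat)
    (D : {set {set {set 'I_(2 * n)}}}) : Prop :=
  D \subset perfect_matchings n /\
  forall T : {set {set 'I_(2 * n)}}, is_matching T -> #|T| = t ->
    #|[set M in D | T \subset M]| = lambda.

Definition is_steiner_system (n t : nat)
    (D : {set {set {set 'I_(2 * n)}}}) : Prop := is_design t 1 D.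

Definition intersection_number (n : nat) (D : {set {set {set 'I_(2 * n)}}})
    (r : nat) (M : {set {set 'I_(2 * n)}}) : nat :=
  #|[set M' in D | #|M :&: M'| == r]|.

(* (2k-1)!! = 1 * 3 * ... * (2k-1), the empty product 1 when k = 0. *)
Definition odd_dfact (k : nat) : nat := \prod_(1 <= i < k.+1) (2 * i - 1).

(* Main.v *)
Require Import Defs.
From mathcomp Require Import all_boot all_order all_algebra.
From mathcomp Require Import zify.

Set Implicit Arguments.
Unset Strict Implicit.
Unset Printing Implicit Defensive.

Import Order.TTheory GRing.Theory Num.Theory.
Local Open Scope ring_scope.

(** The proof is a double count followed by binomial inversion.

    In a Steiner system of strength [t], the number of members containing a
    given matching [T] depends only on [j = #|T|] when [j <= t]: every perfect
    matching containing [T] has exactly one edge at a vertex [v] missed by [T],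
    that edge can be drawn in [2 (n - j) - 1] ways, so passing from [j + 1] to
    [j] multiplies the count by [2 (n - j) - 1].  Starting from the count [1]
    at [j = t], this gives [(2 (n - j) - 1)!! / (2 (n - t) - 1)!!]
    ([steiner_count_supersets]).

    Fix [M] in [D].  Counting the pairs [(M', T)] with [M' != M] in [D] and
    [T] a [j]-subset of [M :&: M'] in two ways gives the binomial moments
    of the sizes [#|M :&: M'|] ([steiner_moment]).  Two distinct members share
    fewer than [t] edges ([steiner_cap_small]), so the moments with [j < t]
    determine the distribution of those sizes, and the alternating sum
    [binomial_inversion_indicator] recovers it.  The member [M] itself
    contains every [T] counted here and is removed from each count, whence the
    [-1] in each term of the formula; it contributes only to [r = n]. *)

(** * Matchings *)

Section Matchings.

Variable V : finType.
Implicit Types (M T : {set {set V}}) (v w : V).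

Lemma matching_card_edge M (e : {set V}) :
  is_matching M -> e \in M -> #|e| = 2.
Proof. by case/andP=> /forall_inP eM _ /eM /eqP. Qed.

Lemma sub_matching M T : is_matching M -> T \subset M -> is_matching T.
Proof.
case/andP=> /forall_inP eM tM sTM; apply/andP; split; last exact: trivIsetS tM.
by apply/forall_inP=> e /(subsetP sTM) /eM.
Qed.

Lemma card_cover_matching M : is_matching M -> #|cover M| = (2 * #|M|)%N.
Proof.
move=> mM; have /andP[_ /eqP <-] := mM.
by rewrite (eq_bigr (fun=> 2)) ?sum_nat_const 1?mulnC // => e /(matching_card_edge mM).
Qed.

Lemma matching_add_edge T v w :
  is_matching T -> v \notin cover T -> w \notin v |: cover T ->
  is_matching ([set v; w] |: T) /\ #|[set v; w] |: T| = #|T|.+1.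
Proof.
move=> mT vT; rewrite in_setU1 negb_or => /andP[wv wT].
have /andP[/forall_inP eT tT] := mT.
have disj e : e \in T -> [disjoint [set v; w] & e].
  move=> Te; have sub u : u \in e -> u \in cover T.
    by move=> ue; apply/bigcupP; exists e.
  rewrite -setI_eq0; apply/eqP/setP=> u; rewrite !inE.
  by apply/negP=> /andP[/orP[]/eqP-> /sub]; apply/negP.
have newT : [set v; w] \notin T.
  by apply: contra vT => eT'; apply/bigcupP; exists [set v; w]; rewrite // !inE eqxx.
split; last by rewrite cardsU1 newT.
apply/andP; split.
  by apply/forall_inP=> e /setU1P[->|/eT //]; rewrite /is_edge cards2 (eq_sym v) wv.
apply/trivIsetP=> A B /setU1P[->|TA] /setU1P[->|TB]; rewrite ?eqxx //.
- by move=> _; apply: disj.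
- by rewrite disjoint_sym => _; apply: disj.
- by move=> neAB; apply: (trivIsetP tT).
Qed.

(** The partner of [v] in [M] also avoids [T], because the edges of [M] are
    disjoint and the edge of [M] at [v] is not in [T]. *)
Lemma unique_partner M T v :
  is_matching M -> v \in cover M -> T \subset M -> v \notin cover T ->
  #|[set w in ~: (v |: cover T) | [set v; w] \in M]| = 1%N.
Proof.
move=> mM vM sTM vT; have /andP[_ tM] := mM.
have eM := pblock_mem vM; have ve : v \in pblock M v by rewrite mem_pblock.
have := matching_card_edge mM eM => /eqP /cards2P[a [b [neab e_ab]]].
have [w nevw e_vw] : exists2 w, w != v & pblock M v = [set v; w].
  move: ve; rewrite e_ab !inE => /orP[]/eqP->; first by exists b; rewrite // eq_sym.
  by exists a; rewrite // setUC.
apply/eqP/cards1P; exists w; apply/setP=> u; rewrite !inE negb_or.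
apply/idP/eqP=> [/andP[/andP[neuv _] uM]|->].
  have: u \in pblock M v by rewrite (def_pblock tM uM) !inE eqxx ?orbT.
  by rewrite e_vw !inE (negPf neuv) => /eqP.
rewrite nevw -e_vw eM andbT /=; apply: contra vT => /bigcupP[f fT wf].
have we : w \in pblock M v by rewrite e_vw !inE eqxx orbT.
apply/bigcupP; exists f => //.
by rewrite -(def_pblock tM (subsetP sTM _ fT) wf) (def_pblock tM eM we).
Qed.

(** By [unique_partner], the edge at [v] sorts the members containing [T] into
    disjoint classes. *)
Lemma count_supersets_split (D : {set {set {set V}}}) T v :
  {in D, forall M, is_matching M /\ v \in cover M} -> v \notin cover T ->
  #|[set M in D | T \subset M]| =
    (\sum_(w in ~: (v |: cover T)) #|[set M in D | [set v; w] |: T \subset M]|)%N.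
Proof.
move=> DP vT; rewrite -sum1_card.
under [RHS]eq_bigr => w _ do rewrite -sum1_card.
rewrite [RHS](exchange_big_dep (mem [set M in D | T \subset M])) /=; last first.
  by move=> w M _; rewrite !inE subUset => /and3P[-> _ ->].
apply: eq_bigr => M; rewrite inE => /andP[DM sTM].
have [mM vM] := DP M DM.
rewrite -[LHS](unique_partner mM vM sTM vT) -sum1_card.
by apply: eq_bigl => w; rewrite !inE subUset sub1set DM sTM andbT.
Qed.

End Matchings.

(** * Designs of perfect matchings *)

Lemma perfect_matching_cover n (M : {set {set 'I_(2 * n)}}) :
  M \in perfect_matchings n -> is_matching M /\ cover M = setT.
Proof.
rewrite inE => /andP[mM /eqP cM]; split=> //.
by apply/eqP; rewrite eqEcard subsetT cardsT card_ord (card_cover_matching mM) cM leqnn.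
Qed.

Lemma odd_dfactS k : odd_dfact k.+1 = (odd_dfact k * (2 * k + 1))%N.
Proof. by rewrite /odd_dfact big_nat_recr //=; congr (_ * _)%N; lia. Qed.

Lemma odd_dfact_gt0 k : (0 < odd_dfact k)%N.
Proof.
elim: k => [|k IHk]; first by rewrite /odd_dfact big_nil.
by rewrite odd_dfactS muln_gt0 IHk addn1.
Qed.

Section Designs.

Variables (n t : nat) (D : {set {set {set 'I_(2 * n)}}}).
Hypothesis ht : (t <= n)%N.
Implicit Types M T : {set {set 'I_(2 * n)}}.

(** Induction on the number [t - #|T|] of edges by which [T] has to be
    extended before the design property applies. *)
Lemma design_count_supersets lambda T :
  is_design t lambda D -> is_matching T -> (#|T| <= t)%N ->
  (#|[set M in D | T \subset M]| * odd_dfact (n - t) =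
     lambda * odd_dfact (n - #|T|))%N.
Proof.
case=> sD hD; have [k] := ubnP (t - #|T|); elim: k T => // k IHk T ltk mT leTt.
have [eqTt|neTt] := eqVneq #|T| t; first by rewrite hD // eqTt.
have ltTt : (#|T| < t)%N by rewrite ltn_neqAle neTt.
have cT := card_cover_matching mT.
have [v vT] : exists v, v \notin cover T.
  apply/existsP; rewrite -negb_forall; apply/negP=> /forallP covT.
  have := subset_leq_card (introT subsetP (fun v _ => covT v) : setT \subset cover T).
  by rewrite cardsT card_ord cT; lia.
rewrite (@count_supersets_split _ D T v) //; last first.
  by move=> M /(subsetP sD) /perfect_matching_cover[mM ->].
rewrite big_distrl /=.
rewrite (eq_bigr (fun=> lambda * odd_dfact (n - #|T|.+1))%N); last first.
  move=> w; rewrite inE => wT; have [mU cU] := matching_add_edge mT vT wT.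
  by rewrite IHk ?cU //; lia.
have -> : (n - #|T|)%N = (n - #|T|.+1).+1 by lia.
rewrite sum_nat_const odd_dfactS [in RHS]mulnA [RHS]mulnC; congr (_ * _)%N.
(* The vertices outside T and v number 2 n - 2 #|T| - 1. *)
by have := cardsC (v |: cover T); rewrite card_ord cardsU1 vT cT; move: #|~: _| => c; lia.
Qed.

Hypothesis hD : is_steiner_system t D.

Lemma steiner_count_supersets T :
  is_matching T -> (#|T| <= t)%N ->
  #|[set M in D | T \subset M]|%:R =
    (odd_dfact (n - #|T|))%:R / (odd_dfact (n - t))%:R :> rat.
Proof.
move=> mT leTt; have := design_count_supersets hD mT leTt.
rewrite mul1n => <-; rewrite natrM mulfK // pnatr_eq0 -lt0n.
exact: odd_dfact_gt0.
Qed.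

Variable M : {set {set 'I_(2 * n)}}.
Hypothesis hM : M \in D.

Let mM : is_matching M.
Proof. by case/perfect_matching_cover: (subsetP hD.1 _ hM). Qed.

Let cM : #|M| = n.
Proof. by have:= subsetP hD.1 _ hM; rewrite inE => /andP[_ /eqP]. Qed.

(** Otherwise a [t]-subset of the intersection would lie in two members. *)
Lemma steiner_cap_small M' : M' \in D :\ M -> (#|M :&: M'| < t)%N.
Proof.
case/setD1P=> neM DM'; rewrite ltnNge; apply/negP=> le_t.
have [T] : exists T, T \in [set T : {set {set _}} | T \subset M :&: M' & #|T| == t].
  by apply/set0Pn; rewrite -card_gt0 cards_draws bin_gt0.
rewrite inE subsetI => /andP[/andP[sTM sTM'] /eqP cT].
have /eqP/cards1P[N eqN] := hD.2 T (sub_matching mM sTM) cT.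
have: M \in [set N] by rewrite -eqN inE hM.
have: M' \in [set N] by rewrite -eqN inE DM'.
by move=> /set1P eqM'N /set1P eqMN; rewrite eqM'N eqMN eqxx in neM.
Qed.

(** Double count of the pairs [(M', T)] with [T] a [j]-subset of [M :&: M']:
    by [M'] on the left, by [T] on the right. *)
Lemma steiner_moment j : (j <= t)%N ->
  \sum_(M' in D :\ M) 'C(#|M :&: M'|, j)%:R =
    'C(n, j)%:R * ((odd_dfact (n - j))%:R / (odd_dfact (n - t))%:R - 1) :> rat.
Proof.
move=> le_jt.
pose subs := [set T : {set {set 'I_(2 * n)}} | T \subset M & #|T| == j].
have -> : \sum_(M' in D :\ M) 'C(#|M :&: M'|, j)%:R =
    \sum_(T in subs) (#|[set M' in D :\ M | T \subset M']|)%:R :> rat.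
  rewrite -!natr_sum; congr (_%:R).
  under eq_bigr => M' _ do rewrite -cards_draws -sum1_card.
  under [RHS]eq_bigr => T _ do rewrite -sum1_card.
  rewrite (exchange_big_dep (mem subs)) /=; last first.
    by move=> M' T _; rewrite !inE subsetI => /andP[/andP[-> _] ->].
  apply: eq_bigr => T; rewrite !inE => /andP[sTM cT]; apply: eq_bigl => M'.
  by rewrite !inE subsetI sTM cT andbT.
rewrite (eq_bigr (fun=> (odd_dfact (n - j))%:R / (odd_dfact (n - t))%:R - 1)).
  by rewrite sumr_const cards_draws cM [RHS]mulr_natl.
move=> T; rewrite inE => /andP[sTM /eqP cT].
have := steiner_count_supersets (sub_matching mM sTM); rewrite cT => <- //.
rewrite [in RHS](cardsD1 M) inE hM sTM natrD addrC addKr.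
by congr (#|pred_of_set _|%:R); apply/setP=> M'; rewrite !inE andbA.
Qed.

End Designs.

(** * Binomial inversion *)

(** Both sides count the chains of an [r]-set inside an [(r + s)]-set inside a
    fixed [m]-set; the right-hand side chooses the smaller set first. *)
Lemma mul_bin_subset m r s :
  ('C(m, r + s) * 'C(r + s, r) = 'C(m, r) * 'C(m - r, s))%N.
Proof.
have [le_m|lt_m] := leqP (r + s) m; last first.
  rewrite bin_small // mul0n; have [lt_mr|le_rm] := ltnP m r.
    by rewrite bin_small.
  by rewrite (@bin_small (m - r)) ?muln0 // ltn_subLR.
have f_gt0 : (0 < r`! * (s`! * (m - r - s)`!))%N by rewrite !muln_gt0 !fact_gt0.
apply/eqP; rewrite -(eqn_pmul2r f_gt0); apply/eqP.
have e1 := bin_fact le_m; have e2 := bin_fact (leq_addr s r).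
have e3 : ('C(m, r) * (r`! * (m - r)`!) = m`!)%N by apply: bin_fact; lia.
have e4 : ('C(m - r, s) * (s`! * (m - r - s)`!) = (m - r)`!)%N by apply: bin_fact; lia.
rewrite addKn in e2; rewrite subnDA -e2 in e1.
transitivity m`!; first by rewrite -e1; lia.
by rewrite -e3 -e4; lia.
Qed.

Lemma alternating_sum_bin m k : (m < k)%N ->
  \sum_(0 <= s < k) (-1) ^+ s * 'C(m, s)%:R = (m == 0%N)%:R :> rat.
Proof.
move=> lt_mk; rewrite (big_cat_nat (n := m.+1)) //=.
rewrite [X in _ + X]big_nat [X in _ + X]big1 ?addr0.
  rewrite -expr0n -(subrr 1) exprBn big_mkord; apply: eq_bigr => s _.
  by rewrite !expr1n !mulr1 mulr_natr.
by move=> s /andP[lt_ms _]; rewrite bin_small // mulr0.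
Qed.

(** By [mul_bin_subset] the sum is ['C(x, r)] times the expansion of
    [(1 - 1) ^+ (x - r)]; the bound [x < t] makes the range of [s] reach every
    nonzero term of that expansion. *)
Lemma binomial_inversion_indicator t r x : (x < t)%N ->
  \sum_(0 <= s < t - r) (-1) ^+ s * 'C(r + s, r)%:R * 'C(x, r + s)%:R =
    (x == r)%:R :> rat.
Proof.
move=> lt_xt.
have -> : \sum_(0 <= s < t - r) (-1) ^+ s * 'C(r + s, r)%:R * 'C(x, r + s)%:R =
    'C(x, r)%:R * \sum_(0 <= s < t - r) (-1) ^+ s * 'C(x - r, s)%:R :> rat.
  rewrite big_distrr; apply: eq_bigr => s _ /=.
  by rewrite mulrCA -natrM -mul_bin_subset mulnC natrM mulrA.
have [lt_xr|le_rx] := ltnP x r; first by rewrite bin_small // mul0r ltn_eqF.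
rewrite alternating_sum_bin; last by rewrite ltn_sub2r // (leq_ltn_trans le_rx).
have -> : (x - r == 0)%N = (x == r) by rewrite subn_eq0 [in RHS]eqn_leq le_rx andbT.
by case: eqP => [->|_]; rewrite ?binn ?mulr0 ?mulr1.
Qed.

(** * Intersection numbers *)

Theorem corollary8 (n t : nat) (D : {set {set {set 'I_(2 * n)}}})
    (ht : (t <= n)%N) (hD : is_steiner_system t D)
    (M : {set {set 'I_(2 * n)}}) (hM : M \in D) (r : nat) (hr : (r <= n)%N) :
  (intersection_number D r M)%:R =
    (if (r < t)%N then
       'C(n, r)%:R *
       \sum_(0 <= s < (t - 1 - r).+1)
         (-1) ^+ s * 'C(n - r, s)%:R *
         ((odd_dfact (n - r - s))%:R / (odd_dfact (n - t))%:R - 1)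
     else if (r < n)%N then 0
     else 1) :> rat.
Proof.
have cM : #|M| = n by have := subsetP hD.1 _ hM; rewrite inE => /andP[_ /eqP].
(* The member M meets itself in all n edges; it is split off. *)
have -> : (intersection_number D r M)%:R =
    (n == r)%:R + \sum_(M' in D :\ M) (#|M :&: M'| == r)%:R :> rat.
  rewrite -natr_sum -natrD; congr (_%:R).
  rewrite /intersection_number -sum1_card big_mkcond /= (bigD1 M) //= inE hM setIid cM.
  congr (_ + _)%N.
  rewrite big_mkcond [RHS]big_mkcond; apply: eq_bigr => M' _; rewrite !inE.
  by case: (M' == M); case: (M' \in D); case: (_ == r).
case: (ltnP r t) => [lt_rt|le_tr]; last first.
  rewrite big1 ?addr0 => [|M' /(steiner_cap_small hD hM) lt_t].
    by rewrite ltn_neqAle hr andbT eq_sym; case: eqP.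
  by rewrite ltn_eqF // (leq_trans lt_t).
rewrite (gtn_eqF (leq_trans lt_rt ht)) add0r.
have -> : (t - 1 - r).+1 = (t - r)%N by lia.
under eq_bigr => M' M'D.
  rewrite -(binomial_inversion_indicator r (steiner_cap_small hD hM M'D)).
  over.
rewrite exchange_big big_distrr /= !big_nat; apply: eq_bigr => s /andP[_ lt_s].
rewrite -big_distrr /= (steiner_moment ht hD hM); last by lia.
rewrite subnDA !mulrA; congr (_ * _).
by rewrite -[LHS]mulrA -natrM mulnC mul_bin_subset natrM mulrCA mulrA.
Qed.
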